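(* Let $\gamma>0$ and suppose that $f:\mathbb R\setminus\mathbb Z\to\mathbb R$ is $1$-periodic, continuous on $(0,1)$, satisfies $f(0+)=-\infty$, $f(1-)=+\infty$, and $f(y)-f(x)\ge\gamma(y-x)$ for all $0<x<y<1$. Then, for every $\alpha\in\mathbb R\setminus\mathbb Q$, the integrated density of states $N$ of the operator family $H(x)$ is Lipschitz continuous with $$|N(E)-N(E')|\le\gamma^{-1}|E-E'|\quad\text{for all }E,E'\in\mathbb R.$$
   Context: For $x\in\mathbb R\setminus(\mathbb Z+\alpha\mathbb Z)$, $H(x)$ is the self-adjoint operator on $\ell^2(\mathbb Z)$ given by $(H(x)\psi)(n)=\psi(n+1)+\psi(n-1)+f(x+n\alpha)\psi(n)$. For $n\in\mathbb N$, $H_n(x)$ is the $n\times n$ matrix which is the Dirichlet restriction of $H(x)$ to $[0,n-1]\cap\mathbb Z$ (diagonal entries $f(x+l\alpha)$, $0\le l\le n-1$; entries $1$ on the two adjacent diagonals), defined for all $x\in[0,1)$ except finitely many points. $N_n(x,E)$ is the number of eigenvalues of $H_n(x)$ in $(-\infty,E]$. The integrated density of states is $$N(E)=\lim_{n\to\infty}\frac1n\int_{[0,1)}N_n(x,E)\,dx.$$ *)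

(* Defs.v *)
From HB Require Import structures.
From mathcomp Require Import all_boot all_order all_algebra.
From mathcomp Require Import all_classical all_reals all_analysis.
Set Implicit Arguments.
Unset Strict Implicit.
Unset Printing Implicit Defensive.
Import Order.TTheory GRing.Theory Num.Theory.
Import numFieldNormedType.Exports.
Local Open Scope classical_set_scope.
Local Open Scope ring_scope.

Section IntegratedDensityOfStates.
Variable R : realType.

(* A function on R \ Z is represented by a total function f : R -> R whose
   values at the integers are irrelevant: they only affect the finite-volume
   matrices for finitely many x in [0, 1). *)

Definition schrodinger (f : R -> R) (alpha x : R) (psi : int -> R) (n : int) : R :=
  psi (n + 1) + psi (n - 1) + f (x + n%:~R * alpha) * psi n.

(* The Dirichlet restriction to [0, n - 1], as the matrix with entries
   <delta_i, H(x) delta_j>. *)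
Definition dirichlet (f : R -> R) (alpha : R) (n : nat) (x : R) : 'M[R]_n :=
  \matrix_(i, j) schrodinger f alpha x (fun k => (k == j%:Z)%:R) i%:Z.

(* Eigenvalues are counted with multiplicity; the sum ranges over a finite set
   (see finite_eigenvalues). *)
Definition eigenvalue_count n (A : 'M[R]_n) (E : R) : nat :=
  \sum_(l \in [set l : R | eigenvalue A l /\ l <= E]) \rank (eigenspace A l).

Definition mean_count (f : R -> R) (alpha : R) (n : nat) (E : R) : R :=
  n%:R^-1 * Rintegral (@lebesgue_measure R) `[0, 1[
    (fun x => (eigenvalue_count (dirichlet f alpha n x) E)%:R).

Definition ids (f : R -> R) (alpha E : R) : R :=
  lim (mean_count f alpha n E @[n --> \oo]).

Lemma finite_eigenvalues n (A : 'M[R]_n) : finite_set [set l | eigenvalue A l].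
Proof.
suff roots_seq (p : {poly R}) : p != 0 ->
    exists s : seq R, forall x, root p x -> x \in s.
  have [|s sP] := roots_seq (char_poly A).
    by rewrite monic_neq0 // char_poly_monic.
  apply: (sub_finite_set (B := [set` s])); last exact: finite_seq.
  by move=> l /=; rewrite eigenvalue_root_char => /sP.
have [m] := ubnP (size p); elim: m p => // m IHm p; rewrite ltnS => pm p0.
have [[x px]|nr] := pselect (exists x, root p x); last first.
  by exists [::] => x px; case: nr; exists x.
have /factor_theorem[q pq] := px.
have q0 : q != 0 by apply: contraNneq p0 => q0; rewrite pq q0 mul0r.
have sq : (size q < m)%N.
  by apply: leq_trans pm; rewrite pq size_Mmonic ?monicXsubC // size_XsubC addn2.
have [s sP] := IHm q sq q0; exists (x :: s) => y.
rewrite pq rootM root_XsubC inE => /orP[/sP ->|->//].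
by rewrite orbT.
Qed.

Lemma dirichletE f alpha n x (i j : 'I_n) :
  dirichlet f alpha n x i j =
    if i == j then f (x + i%:R * alpha)
    else ((i == j.+1 :> nat) || (j == i.+1 :> nat))%:R.
Proof.
rewrite mxE /schrodinger -pmulrn subr_eq -!PoszD !eqz_nat !addn1.
have [<-|ij] := eqVneq i j.
  by rewrite eqxx (gtn_eqF (ltnSn i)) (ltn_eqF (ltnSn i)) mulr1 !add0r.
rewrite (negbTE (ij : (i : nat) != j)) mulr0 addr0 (eq_sym i.+1) -natrD.
congr (_%:R); case: (eqVneq (i : nat) j.+1) => [->|_]; last by rewrite addn0.
by rewrite (ltn_eqF (ltnW (ltnSn j.+1))).
Qed.

End IntegratedDensityOfStates.

(* Main.v *)
Require Import Defs.
From HB Require Import structures.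
From mathcomp Require Import all_boot all_order all_algebra.
From mathcomp Require Import spectral complex.
From mathcomp Require Import all_classical all_reals all_analysis.
From mathcomp Require Import measurable_realfun zify lra.
Set Implicit Arguments.
Unset Strict Implicit.
Unset Printing Implicit Defensive.
Import Order.TTheory GRing.Theory Num.Theory.
Import numFieldNormedType.Exports.
Local Open Scope classical_set_scope.
Local Open Scope ring_scope.

(* Fix 0 <= d < 1.  Passing from x to x + d raises every diagonal entry of the
   Dirichlet matrix by at least gamma d, except for the entries whose argument
   crosses an integer.  By the variational characterization of the eigenvalue
   count of a symmetric matrix, each exceptional entry costs at most one
   eigenvalue, so
     N_n(x + d, E + gamma d) <= N_n(x, E) + #{crossings}.
   Integrating over a period, the left-hand side does not feel the translation
   and the mean number of crossings is n d, whence
     mean N_n(., E + gamma d) <= mean N_n(., E) + n d.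
   The limit exists by Fekete's lemma: deleting the coordinate n - 1 decouples
   the matrix of size n + m, so N_{n+m}(x) >= N_n(x) + N_m(x + n alpha) - 1. *)

(** * Variational characterization of the eigenvalue count of a real symmetric matrix *)

Section SymmetricMatrix.
Variable R : realType.

Lemma mxminpoly_similar_diag (F : fieldType) n (A P : 'M[F]_n.+1) d :
  P \in unitmx -> A = invmx P *m diag_mx d *m P ->
  mxminpoly A = mxminpoly (diag_mx d).
Proof.
by move=> Pu ->; rewrite -conjVmx// mxminpoly_uconj// unitmx_inv.
Qed.

(* The minimal polynomial over R[i] splits with simple real roots by the complex
   spectral theorem, and it is also the minimal polynomial over R. *)
Lemma symmetric_diagonalizable n (A : 'M[R]_n) : A^T = A -> diagonalizable A.
Proof.
case: n A => [|n] A AT; first by rewrite [A]thinmx0; exact: diagonalizable0.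
pose C := real_complex R; set B : 'M[R[i]]_n.+1 := map_mx C A.
have Bherm : B \is hermsymmx.
  apply: realsym_hermsym.
    apply/is_hermitianmxP; rewrite expr0 scale1r.
    by apply/matrixP => i j; rewrite !mxE -{1}AT mxE.
  by apply/mxOverP => i j; rewrite mxE complex_real.
have /mxOverP := hermitian_spectral_diag_real Bherm.
have /hermitian_normalmx/orthomx_spectralP := Bherm.
have := spectral_unit B.
move: (spectralmx B) (spectral_diag B) => P d Pu BE dreal.
have Bmin := mxminpoly_similar_diag Pu BE.
apply/diagonalizableP.
exists (undup [seq complex.Re (d 0 i) | i <- enum 'I_n.+1]).
  exact: undup_uniq.
rewrite -(dvdp_map C) -mxminpoly_map -/B Bmin mxminpoly_diag map_prod_XsubC.
have -> : [seq d 0 i | i <- enum 'I_n.+1] =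
    map C [seq complex.Re (d 0 i) | i <- enum 'I_n.+1].
  by rewrite -(map_comp C); apply: eq_map => i /=; rewrite [C _]RRe_real.
rewrite undup_map_inj; last exact: complexI.
by rewrite big_map dvdpp.
Qed.

Lemma row_norm2 n (u : 'rV[R]_n) : (u *m u^T) 0 0 = \sum_i u 0 i ^+ 2.
Proof. by rewrite !mxE; apply: eq_bigr => i _; rewrite mxE expr2. Qed.

Lemma row_norm2_ge0 n (u : 'rV[R]_n) : 0 <= (u *m u^T) 0 0.
Proof. by rewrite row_norm2 sumr_ge0// => i _; exact: sqr_ge0. Qed.

Lemma row_norm2_le0 n (u : 'rV[R]_n) : (u *m u^T) 0 0 <= 0 -> u = 0.
Proof.
rewrite row_norm2 => u_le0.
have /eqP : \sum_i u 0 i ^+ 2 = 0.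
  by apply: le_anti; rewrite u_le0 sumr_ge0// => i _; exact: sqr_ge0.
rewrite psumr_eq0 => [/allP u0|i _]; last exact: sqr_ge0.
apply/rowP => i; rewrite mxE; apply/eqP.
by have := u0 i (mem_index_enum _); rewrite /= sqrf_eq0.
Qed.

Lemma eigenvector_ortho n (A : 'M[R]_n) (u v : 'rV_n) a b : A^T = A ->
  u *m A = a *: u -> v *m A = b *: v -> a != b -> u *m v^T = 0.
Proof.
move=> AT uA vA ab; have : (a - b) *: (u *m v^T) = 0.
  rewrite scalerBl scalemxAl -uA [in X in _ - X]scalemxAr -linearZ/= -vA.
  by rewrite trmx_mul AT mulmxA subrr.
by move=> /eqP; rewrite scaler_eq0 subr_eq0 (negbTE ab) => /eqP.
Qed.

Definition qform n (A : 'M[R]_n) (u : 'rV_n) : R := (u *m A *m u^T) 0 0.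

Lemma qformE n (A : 'M[R]_n) u :
  qform A u = \sum_i \sum_j u 0 i * A i j * u 0 j.
Proof.
rewrite /qform mxE exchange_big; apply: eq_bigr => j _.
by rewrite !mxE mulr_suml.
Qed.

Lemma qform_shift n (A : 'M[R]_n) E u :
  qform (A - E%:M) u = qform A u - E * (u *m u^T) 0 0.
Proof. by rewrite /qform mulmxBr mulmxBl mul_mx_scalar -scalemxAl !mxE. Qed.

(** Cross terms vanish because eigenvectors of distinct eigenvalues are orthogonal. *)
Lemma qform_sum_eigenvectors n (A : 'M[R]_n) (I : finType) (P : pred I)
    (a : I -> R) (u : I -> 'rV_n) E : A^T = A -> injective a ->
  (forall i, u i *m A = a i *: u i) ->
  qform (A - E%:M) (\sum_(i | P i) u i) =
    \sum_(i | P i) (a i - E) * (u i *m (u i)^T) 0 0.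
Proof.
move=> AT inja uA; rewrite /qform mulmx_suml mulmx_suml summxE.
apply: eq_bigr => i Pi; rewrite mulmxBr uA mul_mx_scalar -scalerBl -scalemxAl mxE.
congr (_ * _); rewrite linear_sum/= mulmx_sumr (bigD1 i)//= big1 ?addr0//.
move=> j /andP[_ ji]; apply: (eigenvector_ortho AT (uA i) (uA j)).
by rewrite (inj_eq inja) eq_sym.
Qed.

(** Replaces the sum over a set of reals in [eigenvalue_count] by a sum over a finite ordinal type,
    on which the splitting into eigenspaces can be used. *)
Lemma symmetric_eigenspaces n (A : 'M[R]_n) : A^T = A ->
  exists m (a : 'I_m -> R), [/\ injective a,
    (\sum_i eigenspace A (a i) :=: 1%:M)%MS &
    forall E, eigenvalue_count A E =
      (\sum_(i | (a i <= E)%R) \rank (eigenspace A (a i)))%N].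
Proof.
move=> AT; have /diagonalizablePeigen[rs rs_uniq] := symmetric_diagonalizable AT.
rewrite (big_nth 0) big_mkord => rs1.
have inja : injective (fun i : 'I_(size rs) => rs`_i).
  by move=> i j /eqP; rewrite nth_uniq// => /eqP/val_inj.
exists (size rs), (fun i => rs`_i); split => // E.
(* The list [rs] misses no eigenvalue: an eigenvector for a value outside it would be orthogonal to
   every eigenspace in a sum that fills the space, hence to itself. *)
have eigen_rs l : eigenvalue A l -> l \in rs.
  move=> /eigenvalueP[v vA]; apply: contraNT => lrs; apply/eqP/row_norm2_le0.
  have /sub_sumsmxP[u vE] : (v <= \sum_(i < size rs) eigenspace A rs`_i)%MS.
    by rewrite rs1 submx1.
  rewrite {1}vE mulmx_suml big1 ?mxE// => i _.
  apply: (eigenvector_ortho AT (a := rs`_i) _ vA).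
    by apply/eigenspaceP; rewrite submxMl.
  by apply: contraNneq lrs => <-; rewrite mem_nth.
rewrite /eigenvalue_count -(big_mkord (fun i => (rs`_i <= E)%R)
  (fun i => \rank (eigenspace A rs`_i))).
rewrite -(big_nth 0 (fun r => (r <= E)%R) (fun r => \rank (eigenspace A r))).
rewrite -big_filter (fsbig_fwiden [seq r <- rs | r <= E]) ?filter_uniq//.
- by move=> l [Al lE] /=; rewrite mem_filter lE eigen_rs.
- move=> l /= []; rewrite mem_filter => /andP[lE _] Al.
  by apply/eqP; rewrite mxrank_eq0; apply: contra_notT Al.
Qed.

(** First half of the variational principle: the sum of the eigenspaces with eigenvalue at most [E]
    attains the count. *)
Lemma eigenvalue_count_subspace n (A : 'M[R]_n) E : A^T = A ->
  exists W : 'M[R]_n, \rank W = eigenvalue_count A E /\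
    forall u : 'rV_n, (u <= W)%MS -> qform (A - E%:M) u <= 0.
Proof.
move=> AT; have [m [a [inja _ countE]]] := symmetric_eigenspaces AT.
exists (\sum_(i | (a i <= E)%R) eigenspace A (a i))%MS; split.
  have /mxdirectP/= -> : mxdirect (\sum_(i | (a i <= E)%R) eigenspace A (a i)).
    by apply: mxdirect_sum_eigenspace => i j _ _; exact: inja.
  by rewrite countE.
move=> u /sub_sumsmxP[v ->].
rewrite (qform_sum_eigenvectors _ _ AT inja); last first.
  by move=> i; apply/eigenspaceP; rewrite submxMl.
apply: sumr_le0 => i iE; rewrite mulr_le0_ge0 ?subr_le0//.
exact: row_norm2_ge0.
Qed.

Lemma eigenvalue_count_le n (A : 'M[R]_n) E : A^T = A ->
  (eigenvalue_count A E <= n)%N.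
Proof.
by move=> /eigenvalue_count_subspace-/(_ E)[W [<- _]]; exact: rank_leq_row.
Qed.

(** Second half, optimality: [W] meets the span [Pos] of the eigenspaces above [E] only in 0, so its
    rank is at most the codimension of [Pos], which is at most the count. *)
Lemma rank_le_eigenvalue_count n (A : 'M[R]_n) E m (W : 'M[R]_(m, n)) :
    A^T = A -> (forall u : 'rV_n, (u <= W)%MS -> qform (A - E%:M) u <= 0) ->
  (\rank W <= eigenvalue_count A E)%N.
Proof.
move=> AT WE; have [k [a [inja a1 countE]]] := symmetric_eigenspaces AT.
pose Neg := (\sum_(i | (a i <= E)%R) eigenspace A (a i))%MS.
pose Pos := (\sum_(i | ~~ (a i <= E)%R) eigenspace A (a i))%MS.
have NegE : (\rank Neg <= eigenvalue_count A E)%N.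
  rewrite countE; exact: (mxrank_sum_leqif _).
have NegPos : (n <= \rank Neg + \rank Pos)%N.
  rewrite -[leqLHS](mxrank1 R) -a1 (bigID (fun i => a i <= E))/=.
  exact: mxrank_adds_leqif.
have WPos : (W :&: Pos = 0)%MS.
  apply/eqP/rowV0P => u; rewrite sub_capmx => /andP[/WE uE /sub_sumsmxP[v uv]].
  pose w i := v i *m eigenspace A (a i).
  have wA i : w i *m A = a i *: w i by apply/eigenspaceP; rewrite submxMl.
  (* For [u] in [Pos] the form is a sum of nonnegative terms; being at most 0, it forces every
     component to vanish. *)
  have w0 i : ~~ (a i <= E) -> w i = 0.
    move=> iE; have aE : 0 < a i - E by rewrite subr_gt0 ltNge.
    apply: row_norm2_le0; rewrite -(pmulr_rle0 _ aE).
    apply: le_trans uE; rewrite uv (qform_sum_eigenvectors _ _ AT inja wA).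
    rewrite (bigD1 i)//= lerDl sumr_ge0// => j /andP[jE _].
    by rewrite mulr_ge0 ?row_norm2_ge0// subr_ge0 ltW// ltNge.
  by rewrite uv big1.
have := rank_leq_col (W + Pos)%MS.
rewrite mxrank_disjoint_sum// => WPosn.
apply: leq_trans NegE; rewrite -(leq_add2r (\rank Pos)).
exact: leq_trans WPosn _.
Qed.

(** Imposing the vanishing of the coordinates in [S] on the optimal subspace for [B] lowers its
    dimension by at most [#|S|]; the remaining subspace is admissible for [A]. *)
Lemma eigenvalue_count_compare n (A B : 'M[R]_n) E E' (S : {set 'I_n}) :
    A^T = A -> B^T = B ->
    (forall u : 'rV_n, (forall i, i \in S -> u 0 i = 0) ->
      qform (B - E'%:M) u <= 0 -> qform (A - E%:M) u <= 0) ->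
  (eigenvalue_count B E' <= eigenvalue_count A E + #|S|)%N.
Proof.
move=> AT BT AB; have [W [<- WE']] := eigenvalue_count_subspace E' BT.
(* [C] extracts the coordinates in [S]; rank-nullity for [C] restricted to [W] gives the loss of
   dimension. *)
pose C : 'M[R]_(n, #|S|) := \matrix_(i, k) (i == enum_val k)%:R.
rewrite -(mxrank_mul_ker W C) addnC leq_add ?rank_leq_col//.
apply: rank_le_eigenvalue_count => // u; rewrite sub_capmx => /andP[/WE' uE' uC].
apply: AB uE' => i iS; move/sub_kermxP: uC => /rowP/(_ (enum_rank_in iS i)).
rewrite !mxE => <-; rewrite (bigD1 i)//= mxE enum_rankK_in// eqxx mulr1.
by rewrite big1 ?addr0// => j /negbTE ji; rewrite mxE enum_rankK_in// ji mulr0.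
Qed.

(** The direct sum of the two optimal subspaces is admissible for the block matrix. *)
Lemma eigenvalue_count_block n1 n2 (A1 : 'M[R]_n1) (A2 : 'M[R]_n2) E :
    A1^T = A1 -> A2^T = A2 ->
  (eigenvalue_count A1 E + eigenvalue_count A2 E
    <= eigenvalue_count (block_mx A1 0 0 A2) E)%N.
Proof.
move=> A1T A2T; have [W1 [<- W1E]] := eigenvalue_count_subspace E A1T.
have [W2 [<- W2E]] := eigenvalue_count_subspace E A2T.
rewrite -rank_diag_block_mx; apply: rank_le_eigenvalue_count => [|u].
  by rewrite tr_block_mx A1T A2T !trmx0.
move=> /submxP[v ->]; rewrite -[v]hsubmxK mul_row_block !mulmx0 addr0 add0r.
have := W1E _ (submxMl (lsubmx v) W1); have := W2E _ (submxMl (rsubmx v) W2).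
set w1 := _ *m W1; set w2 := _ *m W2.
rewrite /qform scalar_mx_block opp_block_mx add_block_mx !subr0.
rewrite mul_row_block !mulmx0 addr0 add0r tr_row_mx mul_row_col.
rewrite [X in _ -> _ -> X <= _]mxE.
by move=> le2 le1; rewrite -[leRHS]addr0 lerD.
Qed.

End SymmetricMatrix.

(** * Comparison and decoupling of Dirichlet matrices *)

Section FiniteVolume.
Variable R : realType.
Implicit Types (f : R -> R) (alpha gamma x E : R) (n m : nat).

Lemma qform_le_diag n (A B : 'M[R]_n) E E' (S : {set 'I_n}) (u : 'rV[R]_n) :
    (forall i j, i != j -> A i j = B i j) ->
    (forall i, i \notin S -> A i i - E <= B i i - E') ->
    (forall i, i \in S -> u 0 i = 0) ->
  qform (A - E%:M) u <= qform (B - E'%:M) u.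
Proof.
move=> AB leAB uS; rewrite !qformE; apply: ler_sum => i _; apply: ler_sum => j _.
have [->|ij] := eqVneq i j; last by rewrite !mxE (negbTE ij) AB.
rewrite !mxE eqxx !mulr1n ![u 0 j * _]mulrC -!mulrA.
have [/uS ->|/leAB] := boolP (j \in S); first by rewrite mulr0 !mulr0.
by apply: ler_wpM2r; rewrite -expr2 sqr_ge0.
Qed.

Definition dcount f alpha n x E := eigenvalue_count (dirichlet f alpha n x) E.

Lemma dirichlet_sym f alpha n x :
  (dirichlet f alpha n x)^T = dirichlet f alpha n x.
Proof.
apply/matrixP => i j; rewrite mxE !dirichletE eq_sym orbC.
by case: eqVneq => // ->.
Qed.

Lemma dcount_le f alpha n x E : (dcount f alpha n x E <= n)%N.
Proof. exact/eigenvalue_count_le/dirichlet_sym. Qed.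

Lemma dcount_compare f g alpha n x y E E' (S : {set 'I_n}) :
    (forall i : 'I_n, i \notin S ->
      f (x + i%:R * alpha) - E <= g (y + i%:R * alpha) - E') ->
  (dcount g alpha n y E' <= dcount f alpha n x E + #|S|)%N.
Proof.
move=> fg; apply: eigenvalue_count_compare; try exact: dirichlet_sym.
move=> u uS; apply: le_trans; apply: qform_le_diag uS => [i j ij|i iS].
  by rewrite !dirichletE (negbTE ij).
by rewrite !dirichletE eqxx fg.
Qed.

Lemma dcountD f alpha n m x E :
  (dcount f alpha n x E + dcount f alpha m (x + n%:R * alpha) E
    <= dcount f alpha (n + m) x E + 1)%N.
Proof.
apply: leq_trans (eigenvalue_count_block E _ _) _; try exact: dirichlet_sym.
(* This is the singleton of the index [n - 1], or the empty set when [n = 0]. *)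
pose S : {set 'I_(n + m)} := [set i : 'I_(n + m) | i.+1 == n :> nat]%SET.
have S1 : (#|S| <= 1)%N.
  apply/card_le1_eqP => i j; rewrite !inE => /eqP in_ /eqP jn.
  by apply/val_inj/succn_inj; rewrite in_ jn.
apply: leq_trans (leq_add (leqnn _) S1).
apply: eigenvalue_count_compare.
- exact: dirichlet_sym.
- by rewrite tr_block_mx !dirichlet_sym !trmx0.
move=> u uS; rewrite !qform_shift.
suff -> : qform (dirichlet f alpha (n + m) x) u = qform (block_mx
  (dirichlet f alpha n x) 0 0 (dirichlet f alpha m (x + n%:R * alpha))) u by [].
(* The only nonzero couplings between the two blocks involve this last coordinate of the first
   block, so they contribute nothing to the form at [u]. *)
have u0 (k : 'I_n) : k.+1 = n :> nat -> u 0 (lshift m k) = 0.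
  by move=> kn; apply: uS; rewrite inE /= kn.
rewrite !qformE; apply: eq_bigr => i _; apply: eq_bigr => j _.
rewrite -(splitK i) -(splitK j).
case: (fintype.split i) => [i1|i2]; case: (fintype.split j) => [j1|j2] /=.
- by rewrite block_mxEul !dirichletE eq_lshift.
- rewrite block_mxEur dirichletE eq_lrshift mxE mulr0 mul0r /=.
  have [/u0->|i1n] := eqVneq i1.+1 n; first by rewrite !mul0r.
  have [h1 h2] := (ltn_ord i1, ltn_ord j2).
  rewrite (_ : _ || _ = false) ?mulr0 ?mul0r//; lia.
- rewrite block_mxEdl dirichletE eq_rlshift mxE mulr0 mul0r /=.
  have [/u0->|i1n] := eqVneq j1.+1 n; first by rewrite !mulr0.
  have [h1 h2] := (ltn_ord i2, ltn_ord j1).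
  rewrite (_ : _ || _ = false) ?mulr0 ?mul0r//; lia.
- rewrite block_mxEdr !dirichletE eq_rshift /= natrD mulrDl addrA.
  by rewrite -!addnS !eqn_add2l.
Qed.

End FiniteVolume.

(** * Effect of a translation on the count, and measurability *)

Section Jumps.
Variable R : realType.
Implicit Types (f g : R -> R) (alpha gamma x d E : R) (n m : nat).

(** Growth at rate [gamma] on each open interval between consecutive integers: equal floors and a
    noninteger [z] put both points in the same one. The values at integers stay unconstrained. *)
Definition increasing_mod1 gamma f := forall z d, 0 <= d ->
  z \isn't a Num.int -> Num.floor (z + d) = Num.floor z ->
  gamma * d <= f (z + d) - f z.

Lemma increasing_mod1_0 gamma f : 0 <= gamma ->
  increasing_mod1 gamma f -> increasing_mod1 0 f.
Proof.
move=> gamma0 fi z d d0 zi zd; rewrite mul0r; apply: le_trans (fi z d d0 zi zd).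
exact: mulr_ge0.
Qed.

(* A starting point in Z counts as a crossing, as f is arbitrary there. *)
Definition crosses d x : bool :=
  (Num.floor (x + d) != Num.floor x) || (x \is a Num.int).

Lemma dcount_jump gamma f alpha n x d E : 0 <= d -> increasing_mod1 gamma f ->
  ((dcount f alpha n (x + d) (E + gamma * d))%:R : R) <=
  (dcount f alpha n x E)%:R + \sum_(i < n) (crosses d (x + i%:R * alpha))%:R.
Proof.
move=> d0 fi; pose S := [set i : 'I_n | crosses d (x + i%:R * alpha)]%SET.
have -> : \sum_(i < n) (crosses d (x + i%:R * alpha))%:R = #|S|%:R :> R.
  rewrite -sum1_card [in RHS]big_mkcond natr_sum/=; apply: eq_bigr => i _.
  by rewrite inE; case: (crosses _ _).
rewrite -natrD ler_nat; apply: dcount_compare => i.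
rewrite inE /crosses negb_or negbK => /andP[/eqP flE xi].
rewrite addrAC; set z := x + _ in flE xi *.
by have := fi z d d0 xi flE; lra.
Qed.

(* The crossings between x and y are dominated by c y - c x, with c as below, so
   the count is the sum of the monotone functions (count - c) and c. *)
Lemma measurable_dcount f alpha n E : increasing_mod1 0 f ->
  measurable_fun setT (fun x : R => (dcount f alpha n x E)%:R : R).
Proof.
move=> fi.
pose c x : R := \sum_(i < n)
  (Num.floor (x + i%:R * alpha) + Num.ceil (x + i%:R * alpha))%:~R.
have c_nd : nondecreasing_fun c.
  move=> x y xy; apply: ler_sum => i _; rewrite ler_int.
  by rewrite lerD ?le_ceil ?le_floor// lerD2r.
have -> : (fun x => (dcount f alpha n x E)%:R) =
    (fun x => (dcount f alpha n x E)%:R - c x) \+ c.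
  by apply/funext => x /=; rewrite subrK.
apply: measurable_funD; last exact: nondecreasing_measurable.
apply: nonincreasing_measurable => // x y; rewrite le_eqVlt => /predU1P[->//|xy].
have d0 : 0 <= y - x by rewrite subr_ge0 ltW.
have := dcount_jump alpha n x E d0 fi; rewrite mul0r addr0 subrKC => xyE.
rewrite lerBlDr (le_trans xyE)// -addrA lerD2l addrC /c -sumrB.
apply: ler_sum => i _; set z := x + _; rewrite /crosses.
have -> : y + i%:R * alpha = z + (y - x) by rewrite /z addrAC subrKC.
have {xy}: 0 < y - x by rewrite subr_gt0.
move: (y - x) z {d0 xyE} => d z d0; rewrite -intrB -mulrz_nat ler_int.
have fl : Num.floor z <= Num.floor (z + d) by rewrite le_floor// lerDl ltW.
have ce : Num.ceil z <= Num.ceil (z + d) by rewrite le_ceil// lerDl ltW.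
(* Floor plus ceiling rises by at least one at every crossing: the ceiling jumps on leaving an
   integer, the floor jumps when a noninteger start reaches or passes one. *)
have [zi|zi] := boolP (z \is a Num.int).
  have : Num.ceil z < Num.ceil (z + d) by rewrite ceil_gt_int ceilK// ltrDl.
  rewrite orbT; lia.
rewrite orbF; case: eqVneq => [->|/eqP]; lia.
Qed.

End Jumps.

(** * Translation invariance of integrals over a period *)

Section PeriodicIntegral.
Variable R : realType.
Local Notation mu := (@lebesgue_measure R).
Implicit Types (u : R -> R) (a b t M : R).

Lemma integrable_bounded_itv u M a b : measurable_fun setT u ->
  (forall x, `|u x| <= M) -> mu.-integrable `[a, b[ (EFin \o u).
Proof.
move=> mu_ uM; apply: measurable_bounded_integrable => //.
- by rewrite /= lebesgue_measure_itv/=; case: ifP => // _; rewrite -EFinB ltry.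
- exact: measurable_funTS.
- by exists M; split => [|r Mr x _]; [exact: num_real|exact: le_trans (uM x) (ltW Mr)].
Qed.

Lemma measurable_translate t :
  measurable_fun setT ((fun x => x + t) : measurableTypeR R -> measurableTypeR R).
Proof. exact: measurable_funD. Qed.

Lemma preimage_translate_itv t a b (c d : bool) :
  (fun x => x + t) @^-1` [set` Interval (BSide c (a + t)) (BSide d (b + t))] =
  [set` Interval (BSide c a) (BSide d b)].
Proof.
apply/seteqP; split => x; rewrite /= !in_itv/=;
by case: c d => -[]; rewrite /= ?lerD2r ?ltrD2r.
Qed.

(** By uniqueness of Lebesgue measure it suffices to compare the two measures on intervals. *)
Lemma lebesgue_measure_translate t (A : set R) : measurable A ->
  pushforward mu ((fun x => x + t) : measurableTypeR R -> measurableTypeR R) A = mu A.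
Proof.
move=> mA; apply/esym/lebesgue_measure_unique => //= [|_ _ [[a b]] _ <-].
  exact: measurable_translate.
rewrite /pushforward -(subrK t a) -(subrK t b) preimage_translate_itv.
rewrite !lebesgue_measure_itv/= !lte_fin ltrD2r; case: ifP => // _.
by rewrite -!EFinB; congr _%:E; lra.
Qed.

Lemma Rintegral_translate u M a b t : measurable_fun setT u ->
  (forall x, `|u x| <= M) ->
  \int[mu]_(x in `[a, b[) u (x + t) = \int[mu]_(x in `[a + t, b + t[) u x.
Proof.
move=> mu_ uM; rewrite /Rintegral; congr fine.
have := @integral_pushforward _ _ _ _ _ _ (measurable_translate t) mu
  `[a + t, b + t[%classic (EFin \o u).
rewrite preimage_translate_itv => <-//.
- apply: eq_measure_integral => //= [|? A mA _]; first exact: measurable_translate.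
  exact: lebesgue_measure_translate.
- exact/measurable_EFinP.
- apply: (@integrable_bounded_itv (fun x => u (x + t)) M) => //.
  by apply: measurableT_comp => //; exact: measurable_translate.
Qed.

Lemma periodicz u : (forall x, u (x + 1) = u x) ->
  forall (k : int) x, u (x + k%:~R) = u x.
Proof.
move=> u1; have un (n : nat) x : u (x + n%:R) = u x.
  by elim: n => [|n IH]; rewrite ?addr0// -natr1 addrA u1.
move=> [n|n] x; first exact: un.
by rewrite NegzE mulrNz -[LHS](un n.+1) -pmulrn subrK.
Qed.

Lemma Rintegral_periodic u M t : measurable_fun setT u ->
  (forall x, `|u x| <= M) -> (forall x, u (x + 1) = u x) ->
  \int[mu]_(x in `[0, 1[) u (x + t) = \int[mu]_(x in `[0, 1[) u x.
Proof.
(* Periodicity reduces [t] to its fractional part [s]; the part of [[s, 1 + s[] beyond 1 is then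
   moved back to [[0, s[]. *)
move=> mu_ uM u1; pose s := t - (Num.floor t)%:~R.
have /andP[s0 s1] : 0 <= s < 1.
  by have := floor_itv t; rewrite intrD /s subr_ge0 ltrBlDl.
transitivity (\int[mu]_(x in `[0, 1[) u (x + s)).
  apply: eq_Rintegral => x _.
  by rewrite -[RHS](periodicz u1 (Num.floor t)) /s -addrA subrK.
have iu a b : mu.-integrable `[a, b[ (EFin \o u) by exact: integrable_bounded_itv.
have split_itv a b c : a <= b -> b <= c ->
    \int[mu]_(x in `[a, c[) u x =
    \int[mu]_(x in `[a, b[) u x + \int[mu]_(x in `[b, c[) u x.
  move=> ab bc; rewrite (@itv_bndbnd_setU _ _ (BLeft a) (BLeft b))//.
  rewrite Rintegral_setU// ?itv_bndbnd_setU//.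
    by rewrite -itv_bndbnd_setU.
  apply/disj_setPS => y [/=]; rewrite 2!in_itv/= => /andP[_ yb] /andP[].
  by rewrite leNgt yb.
have per : \int[mu]_(x in `[1, 1 + s[) u x = \int[mu]_(x in `[0, s[) u x.
  transitivity (\int[mu]_(x in `[0, s[) u (x + 1)).
    by rewrite (Rintegral_translate _ _ _ mu_ uM) add0r addrC.
  by apply: eq_Rintegral => x _; rewrite u1.
rewrite (Rintegral_translate _ _ _ mu_ uM) (split_itv _ 1) ?add0r ?(ltW s1) ?lerDl//.
by rewrite [RHS](split_itv _ s) ?(ltW s1)// addrC per.
Qed.

End PeriodicIntegral.

(** * Mean number of integer crossings *)

Section IntegratedCount.
Variable R : realType.
Local Notation mu := (@lebesgue_measure R).
Implicit Types (f g : R -> R) (alpha gamma x d t E : R) (n m : nat).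

Lemma integrable_addr (dT : measure_display) (T : measurableType dT)
    (nu : {measure set T -> \bar R}) (D : set T) (u v : T -> R) : measurable D ->
    nu.-integrable D (EFin \o u) -> nu.-integrable D (EFin \o v) ->
  nu.-integrable D (EFin \o (fun y => u y + v y)).
Proof. by move=> mD ui vi; have := integrableD mD ui vi. Qed.

Lemma Rintegral_sum (dT : measure_display) (T : measurableType dT)
    (nu : {measure set T -> \bar R})
    (D : set T) (u : nat -> T -> R) n : measurable D ->
    (forall i, nu.-integrable D (EFin \o u i)) ->
  nu.-integrable D (EFin \o (fun y => \sum_(i < n) u i y)) /\
  \int[nu]_(y in D) (\sum_(i < n) u i y) = \sum_(i < n) \int[nu]_(y in D) u i y.
Proof.
move=> mD ui; elim: n => [|n [IHi IH]].
  under [X in EFin \o X]eq_fun do rewrite big_ord0.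
  under eq_Rintegral do rewrite big_ord0.
  rewrite Rintegral_cst// mul0r big_ord0; split => //; exact: integrable0.
under [X in EFin \o X]eq_fun do rewrite big_ord_recr/=.
under eq_Rintegral do rewrite big_ord_recr/=.
rewrite big_ord_recr/= RintegralD// IH; split => //.
exact: integrable_addr.
Qed.

(** Used for measurability. As [d < 1], the floor increment is 0 or 1 and indicates a change of
    floor; the second argument of the maximum is the indicator of the integers. *)
Lemma crossesE d x : 0 <= d < 1 -> (crosses d x)%:R =
  Num.max ((Num.floor (x + d))%:~R - (Num.floor x)%:~R)
    (1 + (Num.floor x)%:~R - (Num.ceil x)%:~R) :> R.
Proof.
move=> /andP[d0 d1]; rewrite /crosses ceil_floor.
have fl : Num.floor x <= Num.floor (x + d) by rewrite le_floor// lerDl.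
have fl1 : Num.floor (x + d) < Num.floor x + 2.
  by rewrite floor_lt_int intrD; have := floorD1_gt x; rewrite intrD; lra.
have -> : (1 + (Num.floor x)%:~R - (Num.floor x + (x \isn't a Num.int))%:~R : R) =
    (x \is a Num.int)%:R.
  by rewrite intrD; case: (x \is a Num.int) => /=; rewrite /=; lra.
case: eqVneq => [->|flx]; first by rewrite subrr max_r.
have -> : Num.floor (x + d) = Num.floor x + 1 by lia.
by rewrite intrD addrAC subrr add0r max_l//; case: (x \is a Num.int).
Qed.

Lemma measurable_crosses d : 0 <= d < 1 ->
  measurable_fun setT (fun x => (crosses d x)%:R : R).
Proof.
move=> d01; under eq_fun do rewrite crossesE//.
have mfloor t : measurable_fun setT (fun x => (Num.floor (x + t))%:~R : R).
  by apply: nondecreasing_measurable => // x y xy; rewrite ler_int le_floor// lerD2r.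
have mfloor0 : measurable_fun setT (fun x => (Num.floor x)%:~R : R).
  by apply: nondecreasing_measurable => // x y xy; rewrite ler_int le_floor.
have mceil : measurable_fun setT (fun x => (Num.ceil x)%:~R : R).
  by apply: nondecreasing_measurable => // x y xy; rewrite ler_int le_ceil.
apply: measurable_maxr; apply: measurable_funB => //.
exact: measurable_funD.
Qed.

Lemma crosses_periodic d x : crosses d (x + 1) = crosses d x.
Proof.
rewrite /crosses addrAC ![Num.floor (_ + 1)]floorDrz// -subr_eq addrK.
by rewrite rpredDr ?rpred1.
Qed.

Lemma Rintegral_crosses d t : 0 <= d < 1 ->
  \int[mu]_(x in `[0, 1[) (crosses d (x + t))%:R = d.
Proof.
move=> d01; have /andP[d0 d1] := d01.
have b1 x : `|(crosses d x)%:R : R| <= 1 by case: (crosses d x); rewrite ?normr1 ?normr0.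
have ic := integrable_bounded_itv _ _ (measurable_crosses d01) b1.
rewrite (Rintegral_periodic t (measurable_crosses d01) b1) => [|x]; last first.
  by rewrite crosses_periodic.
(* The endpoint 0 is dropped, as an integer start always counts as a crossing. On the open interval
   a crossing means [1 - d <= x]. *)
rewrite -Rintegral_itv_obnd_cbnd; last first.
  by apply: integrableS (ic 0 1) => // x; rewrite /= !in_itv/= => /andP[/ltW -> ->].
rewrite (@eq_Rintegral _ _ _ mu _ (\1_`[1 - d, 1[)); last first.
  move=> x; rewrite inE/= in_itv/= => /andP[x0 x1].
  have flx : Num.floor x = 0 by apply/eqP; rewrite floor_eq (ltW x0) add0r.
  have xi : x \isn't a Num.int.
    apply/negP => /intrP[k xk]; move: x0 x1; rewrite xk ltr0z ltrz1; lia.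
  rewrite /crosses flx (negbTE xi) orbF indicE mem_setE in_itv/= x1 andbT.
  congr (_%:R); congr nat_of_bool.
  by rewrite floor_eq mulr0z add0r addr_ge0 ?(ltW x0)//= -leNgt lerBlDr.
rewrite /Rintegral integral_indic// setIidl => [|x]; last first.
  rewrite /= !in_itv/= => /andP[dx ->]; rewrite andbT.
  by apply: lt_le_trans dx; rewrite subr_gt0.
rewrite /= lebesgue_measure_itv/= lte_fin ltrBlDr ltrDl.
case: ltP => [_|]; first by rewrite -EFinB/= subKr.
by move=> d0'; apply/le_anti; rewrite d0.
Qed.

End IntegratedCount.

(** * Estimates for the count integrated over a period *)

Section MeanCount.
Variable R : realType.
Local Notation mu := (@lebesgue_measure R).
Implicit Types (f g : R -> R) (alpha gamma x d t E : R) (n m : nat).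

Lemma dcount_norm f alpha n E x : `|(dcount f alpha n x E)%:R : R| <= n%:R.
Proof. by rewrite normr_nat ler_nat dcount_le. Qed.

Lemma integrable_dcount f alpha n E : increasing_mod1 0 f ->
  mu.-integrable `[0, 1[ (EFin \o (fun x => (dcount f alpha n x E)%:R)).
Proof.
move=> fi; apply: integrable_bounded_itv (measurable_dcount _ _ _ fi) _.
exact: dcount_norm.
Qed.

Definition total_count f alpha n E : R :=
  \int[mu]_(x in `[0, 1[) (dcount f alpha n x E)%:R.

Lemma mean_countE f alpha n E :
  mean_count f alpha n E = n%:R^-1 * total_count f alpha n E.
Proof. by []. Qed.

Lemma integrable_unit_cst c : mu.-integrable `[0, 1[ (EFin \o (fun=> c)).
Proof. by apply: (@integrable_bounded_itv _ _ `|c|) => //; exact: measurable_cst. Qed.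

Lemma Rintegral_unit_cst c : \int[mu]_(x in `[0, 1[) c = c.
Proof.
rewrite Rintegral_cst//= lebesgue_measure_itv/= lte_fin ltr01.
by rewrite -EFinB subr0 mulr1.
Qed.

Lemma total_count_bound f alpha n E : increasing_mod1 0 f ->
  0 <= total_count f alpha n E <= n%:R.
Proof.
move=> fi; rewrite Rintegral_ge0//= -[leRHS](Rintegral_unit_cst n%:R).
apply: le_Rintegral => //.
- exact: integrable_dcount.
- exact: integrable_unit_cst.
- by move=> x _; rewrite ler_nat dcount_le.
Qed.

Lemma total_count_shift g alpha n E t : increasing_mod1 0 g ->
    (forall x, g (x + 1) = g x) ->
  \int[mu]_(x in `[0, 1[) (dcount g alpha n (x + t) E)%:R = total_count g alpha n E.
Proof.
move=> gi g1; apply: (Rintegral_periodic _ (measurable_dcount _ _ _ gi)).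
  exact: dcount_norm.
move=> x; rewrite /dcount.
suff -> : dirichlet g alpha n (x + 1) = dirichlet g alpha n x by [].
by apply/matrixP => i j; rewrite !dirichletE addrAC g1.
Qed.

Lemma integrable_dcount_shift g alpha n E t : increasing_mod1 0 g ->
  mu.-integrable `[0, 1[ (EFin \o (fun x => (dcount g alpha n (x + t) E)%:R)).
Proof.
move=> gi; apply: integrable_bounded_itv (fun x => dcount_norm _ _ _ _ (x + t)).
apply: (measurableT_comp (measurable_dcount alpha n E gi)).
exact: measurable_translate.
Qed.

(** Integrates [dcountD]; periodicity absorbs the translation by [n%:R * alpha] in the second
    block. *)
Lemma total_countD g alpha n m E : increasing_mod1 0 g ->
    (forall x, g (x + 1) = g x) ->
  total_count g alpha n E + total_count g alpha m E
    <= total_count g alpha (n + m) E + 1.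
Proof.
move=> gi g1; rewrite -(total_count_shift alpha m E (n%:R * alpha) gi g1).
rewrite -[X in _ <= _ + X]Rintegral_unit_cst.
rewrite -RintegralD//; try exact: integrable_dcount; try exact: integrable_dcount_shift.
rewrite -RintegralD//; first last.
- exact: integrable_unit_cst.
- exact: integrable_dcount.
apply: le_Rintegral => //.
- by apply: integrable_addr; [|exact: integrable_dcount|exact: integrable_dcount_shift].
- by apply: integrable_addr; [|exact: integrable_dcount|exact: integrable_unit_cst].
- by move=> x _; rewrite -[1]/(1%:R) -!natrD ler_nat dcountD.
Qed.

Lemma total_count_jump gamma g alpha n d E : 0 <= gamma -> 0 <= d < 1 ->
    increasing_mod1 gamma g -> (forall x, g (x + 1) = g x) ->
  total_count g alpha n (E + gamma * d) <= total_count g alpha n E + n%:R * d.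
Proof.
move=> gamma0 d01 gi g1; have gi0 := increasing_mod1_0 gamma0 gi.
rewrite -(total_count_shift alpha n (E + gamma * d) d gi0 g1).
have b1 x : `|(crosses d x)%:R : R| <= 1 by case: (crosses d x); rewrite ?normr1 ?normr0.
have ci i : mu.-integrable `[0, 1[ (EFin \o (fun x => (crosses d (x + i%:R * alpha))%:R)).
  apply: integrable_bounded_itv (fun x => b1 (x + i%:R * alpha)).
  apply: (measurableT_comp (measurable_crosses d01)).
  exact: measurable_translate.
have [//|ciS ciE] := @Rintegral_sum _ _ _ mu `[0, 1[%classic _ n _ ci.
have -> : n%:R * d =
    \int[mu]_(x in `[0, 1[) \sum_(i < n) (crosses d (x + i%:R * alpha))%:R.
  rewrite ciE mulr_natl -[in LHS](card_ord n) -sumr_const.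
  by apply: eq_bigr => i _; rewrite Rintegral_crosses.
rewrite -RintegralD//; last exact: integrable_dcount.
apply: le_Rintegral => //.
- exact: integrable_dcount_shift.
- by apply: integrable_addr => //; exact: integrable_dcount.
- by move=> x _; apply: dcount_jump => //; case/andP: d01.
Qed.

Lemma total_count_mono f alpha n E E' : increasing_mod1 0 f -> E <= E' ->
  total_count f alpha n E <= total_count f alpha n E'.
Proof.
move=> fi EE'; apply: le_Rintegral => //; try exact: integrable_dcount.
move=> x _; rewrite ler_nat -[leqRHS]addn0 -(@cards0 'I_n).
by apply: dcount_compare => i _; rewrite lerB.
Qed.

(** With [d] the energy difference divided by [gamma], the jump estimate covers [d < 1]; for
    [d >= 1] the trivial bounds 0 and [n] on the total count suffice. *)
Lemma total_count_lipschitz gamma g alpha n E E' : 0 < gamma -> (0 < n)%N ->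
    increasing_mod1 gamma g -> (forall x, g (x + 1) = g x) ->
  `|n%:R^-1 * total_count g alpha n E - n%:R^-1 * total_count g alpha n E'|
    <= gamma^-1 * `|E - E'|.
Proof.
move=> gamma0 n0 gi g1; have gi0 := increasing_mod1_0 (ltW gamma0) gi.
wlog EE' : E E' / E' <= E => [H|].
  have [/H//|/ltW/H] := leP E' E; by rewrite (distrC E') => le; rewrite distrC.
rewrite -mulrBr normrM ger0_norm ?invr_ge0//.
rewrite !ger0_norm ?subr_ge0 ?total_count_mono// ler_pdivrMl ?ltr0n//.
set d := gamma^-1 * _; have dE : E = E' + gamma * d.
  by rewrite /d mulVKf ?gt_eqF// subrKC.
have d0 : 0 <= d by rewrite mulr_ge0 ?invr_ge0 ?subr_ge0// ltW.
rewrite lerBlDl; have [d1|d1] := ltP d 1.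
  by rewrite {1}dE total_count_jump ?d0 ?ltW.
have /andP[_ le1] := total_count_bound alpha n E gi0.
have /andP[le2 _] := total_count_bound alpha n E' gi0.
by rewrite (le_trans le1)// ler_wpDl// ler_peMr.
Qed.

Lemma total_count_eq f g alpha n E :
    increasing_mod1 0 f -> increasing_mod1 0 g ->
    (forall x, x \isn't a Num.int -> f x = g x) ->
  total_count f alpha n E = total_count g alpha n E.
Proof.
move=> fi gi fg; rewrite /total_count /Rintegral; congr fine.
(* Countable, hence null, set of the [x] for which some diagonal entry is evaluated at an integer;
   elsewhere the two matrices coincide. *)
pose C := \bigcup_(i in `I_n) \bigcup_(k in [set: int]) [set k%:~R - i%:R * alpha].
have cC : countable C.
  by apply: bigcup_countable => // i _; apply: bigcup_countable.
apply: ae_eq_integral => //.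
- by case/integrableP : (integrable_dcount alpha n E fi).
- by case/integrableP : (integrable_dcount alpha n E gi).
exists C; split.
- by apply: countable_measurable => // t; exact: measurable_set1.
- exact: countable_lebesgue_measure0.
move=> x /= /not_implyP[_]; apply: contra_notP => xC; rewrite /dcount.
suff -> : dirichlet f alpha n x = dirichlet g alpha n x by [].
apply/matrixP => i j; rewrite !dirichletE.
case: eqVneq => // _; apply: fg; apply/negP => /intrP[k xk].
by apply: xC; exists i => //=; exists k => //=; rewrite -xk addrK.
Qed.

End MeanCount.

(** * Fekete's lemma and existence of the limit *)

Lemma superadditive_cvg (R : realType) (v : nat -> R) (M : R) :
    (forall m n, v m + v n <= v (m + n)%N) -> (forall n, v n <= n%:R * M) ->
  cvg (n%:R^-1 * v n @[n --> \oo]).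
Proof.
move=> vD vM; pose S := [set n.+1%:R^-1 * v n.+1 | n in [set: nat]].
have supS : has_sup S.
  split; first by exists (1%:R^-1 * v 1%N), 0%N.
  by exists M => _ [n _ <-]; rewrite ler_pdivrMl ?ltr0n.
have leS n : v n.+1 <= n.+1%:R * sup S.
  by rewrite -ler_pdivrMl ?ltr0n//; apply: ub_le_sup; [case: supS|exists n].
(* Only positive multiples are covered, since [v 0] may be negative. *)
have vMn m k : v m *+ k.+1 <= v (k.+1 * m)%N.
  elim: k => [|k IH]; first by rewrite mul1n.
  by rewrite mulrS mulSn (le_trans _ (vD _ _))// lerD2l.
(* The limit is the supremum of the averages. One half of [e] is spent on an average close to the
   supremum, the other on the remainder of the Euclidean division. *)
apply/cvg_ex; exists (sup S); apply/cvgrPdist_le => e e0.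
have [_ [m _ <-]] := sup_adherent (divr_gt0 e0 (ltr0n R 2)) supS.
set s := sup S - _ => sm.
have {}sm : m.+1%:R * s <= v m.+1 by rewrite -ler_pdivlMl ?ltr0n// ltW.
(* A bound, independent of [n], for the error caused by any remainder modulo [m.+1]. *)
pose K := \sum_(r < m.+1) (`|v r| + `|r%:R * s|).
have vK n : n.+1%:R * s - K <= v n.+1.
  set N := n.+1; set q := (N %/ m.+1)%N; set r := (N %% m.+1)%N.
  have NE : N = (q * m.+1 + r)%N by exact: divn_eq.
  have vq : q%:R * v m.+1 <= v N - v r.
    rewrite NE; case: q {NE} => [|k]; first by rewrite mul0r mul0n add0n subrr.
    by rewrite lerBrDr (le_trans _ (vD _ _))// lerD2r mulr_natl vMn.
  have qs : q%:R * (m.+1%:R * s) <= q%:R * v m.+1 by rewrite ler_wpM2l.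
  have rK : `|v r| + `|r%:R * s| <= K.
    rewrite /K (bigD1 (Ordinal (ltn_pmod N (ltn0Sn m))))//= lerDl.
    by rewrite sumr_ge0// => i _; rewrite addr_ge0.
  have Ns : N%:R * s = q%:R * (m.+1%:R * s) + r%:R * s.
    by rewrite {1}NE natrD natrM mulrDl mulrA.
  have := ler_norm (r%:R * s); have := lerNnormlW (lexx `|v r|).
  rewrite Ns; lra.
near=> n.
have n0 : (0 < n)%N by near: n; exists 1%N.
rewrite ler_distlC; apply/andP; split; last first.
  rewrite -(prednK n0) (le_trans (y := sup S))//; first by rewrite ler_pdivrMl ?ltr0n.
  by rewrite lerDl ltW.
have nK : K <= n%:R * (e / 2).
  rewrite -ler_pdivrMr ?divr_gt0//; near: n; exact: nbhs_infty_ger.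
rewrite ler_pdivlMl ?ltr0n//; have := vK n.-1; rewrite prednK//; apply: le_trans.
rewrite /s; lra.
Unshelve. all: by end_near. Qed.

Lemma total_count_cvg (R : realType) (g : R -> R) alpha E : increasing_mod1 0 g ->
    (forall x, g (x + 1) = g x) ->
  cvg (n%:R^-1 * total_count g alpha n E @[n --> \oo]).
Proof.
(* Subtracting 1 from the total count absorbs the defect in [total_countD] and makes it exactly
   superadditive; the correction [1/n] tends to 0. *)
move=> gi g1; have -> : (fun n => n%:R^-1 * total_count g alpha n E) =
    (fun n => n%:R^-1 * (total_count g alpha n E - 1)) \+ (fun n => n%:R^-1).
  by apply/funext => n /=; rewrite -{3}[n%:R^-1]mulr1 -mulrDr subrK.
apply: is_cvgD.
  apply: (@superadditive_cvg _ _ 1) => [m n|n].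
    by have := total_countD alpha m n E gi g1; lra.
  by have /andP[_] := total_count_bound alpha n E gi; lra.
by apply/cvg_ex; exists 0; rewrite -cvg_shiftS; exact: cvg_harmonic.
Qed.

(** * From the hypotheses on the unit interval to all of the line *)

Section IncreasingMod1.
Variable R : realType.
Implicit Types (gamma x y z d : R) (f g : R -> R).

Lemma noninteger_same_floor z d : 0 <= d -> z \isn't a Num.int ->
  Num.floor (z + d) = Num.floor z -> z + d \isn't a Num.int.
Proof.
move=> d0 zi zd; apply: contraNN zi => /floorK; rewrite zd => kzd.
have z_fl : (Num.floor z)%:~R = z.
  by apply/le_anti; rewrite floor_le kzd lerDl.
by rewrite -z_fl intr_int.
Qed.

Lemma increasing_mod1_ext gamma f g : (forall x, x \isn't a Num.int -> f x = g x) ->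
  increasing_mod1 gamma f -> increasing_mod1 gamma g.
Proof.
move=> fg fi z d d0 zi zd; rewrite -!fg//; first exact: fi.
exact: noninteger_same_floor.
Qed.

(** The integral lemmas need periodicity at every point, whereas the values of [f] at integers are
    arbitrary; setting them to 0 repairs this. *)
Lemma periodic_patch f : (forall x, x \isn't a Num.int -> f (x + 1) = f x) ->
  forall x, (fun y => if y \is a Num.int then 0 else f y) (x + 1) =
            (fun y => if y \is a Num.int then 0 else f y) x.
Proof.
by move=> f1 x; rewrite /= rpredDr ?rpred1//; case: ifPn => // /f1.
Qed.

Lemma increasing_mod1_of_unit gamma f :
    (forall x, x \isn't a Num.int -> f (x + 1) = f x) ->
    (forall x y, 0 < x -> x < y -> y < 1 -> gamma * (y - x) <= f y - f x) ->
  increasing_mod1 gamma f.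
Proof.
move=> f1 f_incr z d; rewrite le_eqVlt => /predU1P[<- _ _|d0 zi zdk].
  by rewrite addr0 subrr mulr0.
have zdi := noninteger_same_floor (ltW d0) zi zdk; move: zdk.
set k := Num.floor z => zdk.
(* Subtracting the common floor [k] brings both points into the open unit interval, where the growth
   hypothesis applies. *)
have fE y : y \isn't a Num.int -> f y = f (y - k%:~R).
  move=> yi; have := periodicz (periodic_patch f1) k (y - k%:~R).
  by rewrite /= subrK rpredBr ?intr_int// (negbTE yi).
have zk y : y \isn't a Num.int -> Num.floor y = k -> 0 < y - k%:~R < 1.
  move=> yi yk; have /andP[] := floor_itv y; rewrite yk intrD => ky yk1.
  rewrite subr_gt0 ltrBlDl yk1 andbT lt_neqAle ky andbT.
  by apply: contraNneq yi => <-; exact: intr_int.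
have /andP[z0 _] := zk z zi erefl; have /andP[_ z1] := zk _ zdi zdk.
rewrite fE// [f z]fE//.
have -> : d = (z + d - k%:~R) - (z - k%:~R) by lra.
have -> : z + (z + d - k%:~R - (z - k%:~R)) - k%:~R = z + d - k%:~R by lra.
by apply: f_incr => //; lra.
Qed.

End IncreasingMod1.

(** * Existence of the density of states and passage of the Lipschitz bound to the limit *)

Theorem theorem4p1 (R : realType) (gamma : R) (f : R -> R)
    (gamma_gt0 : 0 < gamma)
    (f_periodic : forall x : R, x \isn't a Num.int -> f (x + 1) = f x)
    (f_continuous : {in `]0, 1[, continuous f})
    (f_right0 : f x @[x --> 0^'+] --> -oo)
    (f_left1 : f x @[x --> 1^'-] --> +oo)
    (f_monotone : forall x y : R, 0 < x -> x < y -> y < 1 ->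
       gamma * (y - x) <= f y - f x)
    (alpha : R) (alpha_irr : irrational alpha) :
  (forall E : R, cvg (mean_count f alpha n E @[n --> \oo])) /\
  (forall E E' : R,
     `|ids f alpha E - ids f alpha E'| <= gamma^-1 * `|E - E'|).
Proof.
have fi := increasing_mod1_of_unit f_periodic f_monotone.
pose g x := if x \is a Num.int then 0 else f x.
have g1 : forall x, g (x + 1) = g x := periodic_patch f_periodic.
have fg x : x \isn't a Num.int -> f x = g x by rewrite /g => /negbTE ->.
have gi := increasing_mod1_ext fg fi.
have gi0 := increasing_mod1_0 (ltW gamma_gt0) gi.
have fi0 := increasing_mod1_0 (ltW gamma_gt0) fi.
(* Replacing [f] by its periodic patch [g] changes the matrices only on a null set of [x], so all
   means agree. *)
have meanE E : (fun n => mean_count f alpha n E) =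
    (fun n => n%:R^-1 * total_count g alpha n E).
  by apply/funext => n; rewrite mean_countE (total_count_eq _ _ _ fi0 gi0).
have mean_cvg E : cvg (mean_count f alpha n E @[n --> \oo]).
  by rewrite meanE; exact: total_count_cvg.
split=> // E E'; rewrite /ids.
have dist_cvg : `|mean_count f alpha n E - mean_count f alpha n E'| @[n --> \oo] -->
    `|lim (mean_count f alpha n E @[n --> \oo]) -
      lim (mean_count f alpha n E' @[n --> \oo])|.
  by apply: cvg_norm; apply: cvgB; exact: mean_cvg.
apply: cvgr_to_le dist_cvg _; near=> n.
rewrite !mean_countE !(total_count_eq _ _ _ fi0 gi0)//.
apply: total_count_lipschitz => //; near: n; exact: nbhs_infty_gt.
Unshelve. all: by end_near. Qed.
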